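(* Let $f:\mathbb{R}^d\to\mathbb{R}$ be differentiable. Each iteration of Frictionless Hamiltonian Descent applied to $f$, from $x_k$ with integration time $\eta_k$, satisfies $$f(x_{k+1})+\frac12\|v_{k+1}\|_2^2=f(x_k).$$ Consequently $f(x_{k+1})\le f(x_k)$, with strict decrease whenever $v_{k+1}\ne0$.
   Context: Hamiltonian Flow: $\mathsf{HF}_\eta(x_0,v_0)=(x_\eta,v_\eta)$ denotes the value at time $t=\eta$ of the solution (assumed to exist on the time interval considered) of $\frac{dx}{dt}=v$, $\frac{dv}{dt}=-\nabla f(x)$ with initial condition $(x_0,v_0)$ at $t=0$. Frictionless Hamiltonian Descent with integration times $\{\eta_k\}$: starting from $x_1$, for $k=1,2,\dots$ set $(x_{k+1},v_{k+1})=\mathsf{HF}_{\eta_k}(x_k,0)$. *)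

(* Defs.v *)
From HB Require Import structures.
From mathcomp Require Import all_boot all_order all_algebra.
From mathcomp Require Import all_classical all_reals all_analysis.

Set Implicit Arguments.
Unset Strict Implicit.
Unset Printing Implicit Defensive.

Import Order.TTheory GRing.Theory Num.Theory.
Import numFieldNormedType.Exports.

Local Open Scope classical_set_scope.
Local Open Scope ring_scope.

(* The library norm on 'rV[R]_d is the sup norm; this is the Euclidean one. *)
Definition norm2 (R : realType) (d : nat) (v : 'rV[R]_d) : R :=
  Num.sqrt (\sum_(i < d) v ord0 i ^+ 2).

Definition grad (R : realType) (d : nat) (f : 'rV[R]_d -> R) (x : 'rV[R]_d) :
    'rV[R]_d :=
  \row_(i < d) 'D_(delta_mx ord0 i) f x.

(* Derivative at t relative to the time set I: two-sided at interior points of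
   I, one-sided at the endpoints.  Only the values of y on I (and at t)
   matter. *)
Definition has_derivative_within (R : realType) (V : normedModType R)
    (I : set R) (y : R -> V) (t : R) (dy : V) : Prop :=
  (s - t)^-1 *: (y s - y t) @[s --> within I t^'] --> dy.

(* The closed interval between 0 and eta: [0, eta] if 0 <= eta, and [eta, 0]
   for backward integration. *)
Definition time_span (R : realType) (eta : R) : set R :=
  `[Num.min 0 eta, Num.max 0 eta].

Definition hamiltonian_solution (R : realType) (d : nat) (f : 'rV[R]_d -> R)
    (I : set R) (x v : R -> 'rV[R]_d) : Prop :=
  forall t, I t ->
    has_derivative_within I x t (v t) /\
    has_derivative_within I v t (- grad f (x t)).

(* HF_eta(p) = q, as a relation.  When f is merely differentiable, its gradient
   need not be continuous, so a solution with given initial data may fail to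
   exist or to be unique: HF f eta p q says that some solution on the whole
   time span leads from p at time 0 to q at time eta. *)
Definition HF (R : realType) (d : nat) (f : 'rV[R]_d -> R) (eta : R)
    (p q : 'rV[R]_d * 'rV[R]_d) : Prop :=
  exists x v : R -> 'rV[R]_d,
    [/\ hamiltonian_solution f (time_span eta) x v,
        (x 0, v 0) = p & (x eta, v eta) = q].

(* The iterates x_k, v_k and the integration times eta_k are indexed from
   k = 1 (so v_1 and the entries of index 0 are irrelevant). *)
Definition frictionless_HD (R : realType) (d : nat) (f : 'rV[R]_d -> R)
    (eta : nat -> R) (x v : nat -> 'rV[R]_d) : Prop :=
  forall k : nat, (1 <= k)%N -> HF f (eta k) (x k, 0) (x k.+1, v k.+1).

(* Main.v *)
(* The energy f(x) + |v|^2 / 2 is conserved along the Hamiltonian flow: its time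
   derivative is <grad f(x), v> + <v, - grad f(x)> = 0.  Since the gradient
   need not be continuous and the derivatives are one-sided at the endpoints of
   the time span, conservation comes from the mean value theorem, which needs
   two-sided derivatives at interior times and mere continuity on the closed
   interval. *)
Require Import Defs.
From HB Require Import structures.
From mathcomp Require Import all_boot all_order all_algebra.
From mathcomp Require Import all_classical all_reals all_analysis.
From mathcomp Require Import ring.

Set Implicit Arguments.
Unset Strict Implicit.
Unset Printing Implicit Defensive.

Import Order.TTheory GRing.Theory Num.Theory.
Import numFieldNormedType.Exports.

Local Open Scope classical_set_scope.
Local Open Scope ring_scope.

(** For [s != t], [y s] is [y t] plus [s - t] times the difference quotient; the quotient converges
    and [s - t] tends to 0. *)
Lemma has_derivative_within_cvg (R : realType) (V : normedModType R)
    (I : set R) (y : R -> V) (t : R) (dy : V) :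
  has_derivative_within I y t dy -> y @ within I (nbhs t) --> y t.
Proof.
move=> ydy.
have yc : y @ within I t^' --> y t.
  have -> : y t = y t + (t - t) *: dy by rewrite subrr scale0r addr0.
  have : y t + (s - t) *: ((s - t)^-1 *: (y s - y t)) @[s --> within I t^']
           --> y t + (t - t) *: dy.
    apply: cvgD; first exact: cvg_cst.
    apply: cvgZ => //.
    apply: cvgB; last exact: cvg_cst.
    by move=> U tU; apply: cvg_within; exact: cvg_within.
  apply: cvg_trans; apply: near_eq_cvg.
  rewrite !near_withinE; apply: nearW => s /= st _.
  by rewrite scalerA divff ?subr_eq0// scale1r addrC subrK.
(* Passing from the punctured filter to the full one only adds [s = t], where the value is the limit
   itself. *)
move=> U yU.
have : \forall s \near within I t^', U (y s) by exact: yc.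
rewrite /= !near_simpl !near_withinE; apply: filterS => s sU Is.
have [->|st] := eqVneq s t; first exact: nbhs_singleton.
exact: sU.
Qed.

(** The substitution [s = h + t] turns one quotient into the other. Since [I] is a neighbourhood of
    [t], every small nonzero [h] keeps [h + t] in [I]. *)
Lemma has_derivative_within_is_derive (R : realType) (V : normedModType R)
    (I : set R) (y : R -> V) (t : R) (dy : V) :
  nbhs t I -> has_derivative_within I y t dy -> is_derive t 1 y dy.
Proof.
move=> tI ydy.
have ht : (h + t) @[h --> (0 : R)^'] --> within I t^'.
  have h0 : (h + t) @[h --> (0 : R)] --> t.
    rewrite -[X in _ --> X]add0r; apply: cvgD; [exact: cvg_id|exact: cvg_cst].
  move=> U tU; have {}tU : \forall s \near within I t^', U s by [].
  rewrite !near_withinE in tU.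
  have tIU : \forall h \near (0 : R),
      (I `&` [set s | s != t -> I s -> U s]) (h + t).
    by apply: h0; exact: filterI.
  suff : \forall h \near (0 : R)^', U (h + t) by [].
  rewrite near_withinE.
  apply: filterS tIU => h /= [Iht +] h0'; apply => //.
  by rewrite -subr_eq0 addrK.
have ycv : h^-1 *: (y (h *: 1 + t) - y t) @[h --> (0 : R)^'] --> dy.
  have := cvg_comp _ _ ht ydy.
  apply: cvg_trans; apply: near_eq_cvg; apply: nearW => h /=.
  by rewrite addrK [h *: 1]mulr1.
split; first by apply/cvg_ex; exists dy.
exact: cvg_lim.
Qed.

Lemma has_derivative_within_coord (R : realType) (d : nat)
    (I : set R) (y : R -> 'rV[R]_d) (t : R) (dy : 'rV[R]_d) (i : 'I_d) :
  has_derivative_within I y t dy ->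
  has_derivative_within I (fun s => y s ord0 i) t (dy ord0 i).
Proof.
move=> /(continuous_cvg _ (@coord_continuous R 1 d ord0 i _)).
by apply: cvg_trans; apply: near_eq_cvg; apply: nearW => s /=; rewrite !mxE.
Qed.

(** Expand [w] in the standard basis: the differential is linear, and on basis vectors it gives the
    partial derivatives. *)
Lemma diff_gradE (R : realType) (d : nat) (f : 'rV[R]_d -> R)
    (x w : 'rV[R]_d) :
  differentiable f x ->
  'd f x w = \sum_(i < d) w ord0 i * grad f x ord0 i.
Proof.
move=> df; rewrite {1}(row_sum_delta w) linear_sum.
by apply: eq_bigr => i _; rewrite linearZ mxE deriveE.
Qed.

Lemma is_derive0_eq_endpoints (R : realType) (a b : R) (h : R -> R) :
  a <= b ->
  {within `[a, b], continuous h} ->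
  (forall t, t \in `]a, b[%R -> is_derive t 1 h 0) -> h b = h a.
Proof.
move=> ab hc h0; have [c _ /eqP] := MVT_segment ab h0 hc.
by rewrite mul0r subr_eq0 => /eqP.
Qed.

Definition energy (R : realType) (d : nat) (f : 'rV[R]_d -> R)
    (p w : 'rV[R]_d) : R :=
  f p + 2^-1 * \sum_(i < d) w ord0 i ^+ 2.

Lemma energy_is_derive (R : realType) (d : nat) (f : 'rV[R]_d -> R)
    (I : set R) (x v : R -> 'rV[R]_d) (t : R) :
  (forall p, differentiable f p) -> nbhs t I ->
  hamiltonian_solution f I x v ->
  is_derive t 1 (fun s => energy f (x s) (v s)) 0.
Proof.
move=> df tI /(_ t (nbhs_singleton tI))[xt vt].
have [xd xE] := has_derivative_within_is_derive tI xt.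
have vd i : is_derive t 1 (fun s => v s ord0 i) ((- grad f (x t)) ord0 i).
  exact: has_derivative_within_is_derive tI (has_derivative_within_coord vt).
(* For a function of one real variable, derivability is differentiability, so the chain rule for
   differentials applies to [f \o x]. *)
have dx : differentiable x t by exact/derivable1_diffP.
have fxd : is_derive t 1 (f \o x) ('d f (x t) (v t)).
  have dfx : differentiable (f \o x) t by exact: differentiable_comp.
  split; first exact/derivable1_diffP.
  by rewrite deriveE // diff_comp //= -(deriveE _ dx) xE.
(* Written with operations on functions, the energy lets instance inference assemble its
   derivative. *)
have -> : (fun s => energy f (x s) (v s)) =
    (f \o x) + 2^-1 *: (\sum_(i < d) (fun s => v s ord0 i) ^+ 2).
  apply/funext => s; rewrite /energy !fctE fct_sumE.
  by congr (_ + _ * _); apply: eq_bigr => i _; rewrite fctE.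
apply: is_derive_eq.
(* The cancellation is coordinatewise: the factor 2 from the square meets [2^-1], leaving
   [v_i * grad_i - v_i * grad_i]. *)
rewrite diff_gradE // scaler_sumr -big_split big1 //= => i _.
by rewrite !mxE /= expr1 /GRing.scale /=; field.
Qed.

(** Relative derivatives already force relative continuity of [x] and [v], so this also covers the
    endpoints of a time span. *)
Lemma energy_continuous (R : realType) (d : nat) (f : 'rV[R]_d -> R)
    (I : set R) (x v : R -> 'rV[R]_d) :
  (forall p, differentiable f p) -> hamiltonian_solution f I x v ->
  {within I, continuous (fun s => energy f (x s) (v s))}.
Proof.
move=> df sol; apply/subspace_continuousP => t It.
have [/has_derivative_within_cvg xt vt] := sol t It.
apply: cvgD.
  by apply: continuous_cvg xt; exact: differentiable_continuous.
apply: cvgM; first exact: cvg_cst.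
apply: cvg_big => [|i _]; first exact: add_continuous.
have vi := has_derivative_within_cvg (has_derivative_within_coord (i := i) vt).
exact: continuous_cvg (@exprn_continuous R 2 _) vi.
Qed.

Lemma energy_HF (R : realType) (d : nat) (f : 'rV[R]_d -> R) (eta : R)
    (p q : 'rV[R]_d * 'rV[R]_d) :
  (forall z, differentiable f z) -> HF f eta p q ->
  energy f q.1 q.2 = energy f p.1 p.2.
Proof.
move=> df [x [v [sol <- <-]]] /=.
pose a := Num.min 0 eta; pose b := Num.max 0 eta.
have ab : a <= b by rewrite /a /b ge_min le_max lexx.
have Eab : energy f (x b) (v b) = energy f (x a) (v a).
  apply: (@is_derive0_eq_endpoints R a b (fun s => energy f (x s) (v s))) => //.
    exact: energy_continuous.
  move=> t tab; apply: energy_is_derive sol => //.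
  by apply: filterS (near_in_itvoo tab) => s; exact: subset_itv_oo_cc.
(* If [eta <= 0], the endpoints are swapped and the equality is read backwards. *)
by move: Eab; rewrite /a /b /Num.min /Num.max; case: ifP.
Qed.

Lemma norm2_gt0 (R : realType) (d : nat) (w : 'rV[R]_d) :
  w != 0 -> 0 < norm2 w.
Proof.
move=> /rV0Pn[i wi0]; rewrite sqrtr_gt0 (bigD1 i) //=.
apply: ltr_pwDl; first by rewrite exprn_even_gt0.
by apply: sumr_ge0 => j _; exact: sqr_ge0.
Qed.

Theorem mainTheorem9 (R : realType) (d : nat) (f : 'rV[R]_d -> R)
  (f_diff : forall x : 'rV[R]_d, differentiable f x)
  (eta : nat -> R) (x v : nat -> 'rV[R]_d)
  (HD : frictionless_HD f eta x v)
  (k : nat) (k_ge1 : (1 <= k)%N) :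
  [/\ f (x k.+1) + 2^-1 * norm2 (v k.+1) ^+ 2 = f (x k),
      f (x k.+1) <= f (x k)
    & v k.+1 != 0 -> f (x k.+1) < f (x k)].
Proof.
have E : f (x k.+1) + 2^-1 * norm2 (v k.+1) ^+ 2 = f (x k).
  have := energy_HF f_diff (HD k k_ge1); rewrite /energy /=.
  (* Each iteration restarts at rest, so the initial kinetic energy vanishes. *)
  rewrite [X in _ = _ + _ * X]big1 => [|i _]; last by rewrite mxE expr0n.
  by rewrite mulr0 addr0 /norm2 sqr_sqrtr // sumr_ge0 // => i _; exact: sqr_ge0.
split=> //; first by rewrite -E lerDl mulr_ge0 // sqr_ge0.
by move=> v0; rewrite -E ltrDl mulr_gt0 // exprn_gt0 // norm2_gt0.
Qed.
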